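(* For every set $U\subset\mathcal{A}_0(\overline D)$ we have $$U^*=\overline{(\mathrm{cm}(U))^{\perp}},$$ where the closure is taken in the space $\mathcal{A}$.
   Context: $D=\{z:|z|<1\}$, $\overline D$ its closure. $\mathcal{A}$ is the space of functions $f(z)=\sum_{k\ge0}a_k(f)z^k$ analytic in $D$, with the topology of locally uniform convergence; $\mathcal{A}_0=\{f\in\mathcal{A}: a_0(f)=1\}$. $\mathcal{A}(\overline D)$ is the set of functions analytic in some disk $\{|z|<R\}$ with $R>1$, and $\mathcal{A}_0(\overline D)=\{g\in\mathcal{A}(\overline D):a_0(g)=1\}$. The Hadamard product is $(f*g)(z)=\sum_{k\ge0}a_k(f)a_k(g)z^k$. For $U\subset\mathcal{A}_0$, $U^*=\{g\in\mathcal{A}_0:(f*g)(z)\ne0 \text{ for all } z\in D,\ f\in U\}$. For $x\in\overline D$, $(P_xf)(z)=f(xz)$, and $\mathrm{cm}(U)=\{P_xf: f\in U,\ x\in\overline D\}$. For $U\subset\mathcal{A}_0(\overline D)$, $U^{\perp}=\{h\in\mathcal{A}_0:(g*h)(1)\ne0\text{ for all } g\in U\}$. *)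

(* Defs.v *)
From HB Require Import structures.
From mathcomp Require Import all_boot all_order all_algebra.
From mathcomp Require Import all_classical all_reals all_analysis.
From mathcomp Require Import complex.
Set Implicit Arguments. Unset Strict Implicit. Unset Printing Implicit Defensive.
Import Order.TTheory GRing.Theory Num.Theory.
Import numFieldTopology.Exports numFieldNormedType.Exports.
Local Open Scope classical_set_scope.
Local Open Scope ring_scope.

Section Defs.
Variable R : realType.
Definition C : numClosedFieldType := R[i].

(* A power series around 0 is represented by its coefficient sequence a_k(f). *)
Definition pser := nat -> C.

Definition peval (f : pser) (z : C) : C :=
  lim (series (fun k => f k * z ^+ k) @ \oo).

Definition pconv (f : pser) (z : C) : Prop :=
  cvgn (series (fun k => f k * z ^+ k)).

(* A : functions analytic in D (power series converging on the open unit disk) *)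
Definition Aan : set pser := [set f | forall z : C, `|z| < 1 -> pconv f z].
Definition A0 : set pser := [set f | Aan f /\ f 0%N = 1].
Definition Acl : set pser :=
  [set g | exists rho : C, 1 < rho /\ forall z : C, `|z| < rho -> pconv g z].
Definition A0cl : set pser := [set g | Acl g /\ g 0%N = 1].

Definition hadamard (f g : pser) : pser := fun k => f k * g k.

Definition dual_star (U : set pser) : set pser :=
  [set g | A0 g /\ forall f, U f -> forall z : C, `|z| < 1 ->
      peval (hadamard f g) z != 0].

Definition Px (x : C) (f : pser) : pser := fun k => f k * x ^+ k.

Definition cm (U : set pser) : set pser :=
  [set h | exists f x, U f /\ `|x| <= 1 /\ h = Px x f].

Definition perp (U : set pser) : set pser :=
  [set h | A0 h /\ forall g, U g -> peval (hadamard g h) 1 != 0].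

(* closure in A for the topology of locally uniform convergence in D *)
Definition Aclosure (S : set pser) : set pser :=
  [set h | Aan h /\ forall r eps : C, 0 < r -> r < 1 -> 0 < eps ->
     exists g, S g /\ forall z : C, `|z| <= r -> `|peval g z - peval h z| < eps].
End Defs.

(* Main.v *)
(** One inclusion is by dilation: if g is in U^*, then P_r g (0 < r < 1) is in
    (cm U)^perp, because (P_x f * P_r g)(1) = (f * g)(r x), and P_r g -> g.

    The other one is Hurwitz's theorem for f * h_n -> f * h, whose value at 0 is 1.
    It is proved by power series only.  At a zero z0, dividing by the Blaschke
    factor preserves the l^2 norm of the coefficients and increases |F(0)| by the
    factor 1 / |z0|; so the order m of z0 is finite and |F(z)| >= c |z - z0|^m near
    z0.  On the other hand, a zero-free F_n satisfies the minimum principle: after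
    truncation it is a polynomial without roots in the disc, and multiplying its
    values at the N-th roots of unity gives m^N <= 2^deg |F_n(z0)|^N for all N.
    Coefficients are controlled by Cauchy's estimate, reduced to polynomials. *)
Require Import Defs.
From HB Require Import structures.
From mathcomp Require Import all_boot all_order all_algebra.
From mathcomp Require Import all_classical all_reals all_analysis.
From mathcomp Require Import complex.
From mathcomp Require Import ring lra zify.
Import Order.TTheory GRing.Theory Num.Theory.
Import numFieldTopology.Exports numFieldNormedType.Exports.
Local Open Scope classical_set_scope.
Local Open Scope ring_scope.

Set Implicit Arguments.
Unset Strict Implicit.
Unset Printing Implicit Defensive.

(** * Complex modulus with values in the real field *)

Section ComplexModulus.
Variable R : realType.
Local Notation K := (C R).
Implicit Types (z w : K) (x y : R).

(** The norm of [R[i]] takes its values in [R[i]] itself; this real-valued version lets all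
    estimates be carried out in the ordered field [R], with [rc] as the way back. *)
Definition modc (z : K) : R := Normc.normc z.
Arguments modc : simpl never.
Definition rc (x : R) : K := real_complex R x.

Lemma normE z : `|z| = rc (modc z). Proof. by []. Qed.

Lemma rc_le x y : (rc x <= rc y) = (x <= y). Proof. exact: lecR. Qed.
Lemma rc_lt x y : (rc x < rc y) = (x < y). Proof. exact: ltcR. Qed.

Lemma modc_rc x : modc (rc x) = `|x|.
Proof. by rewrite /modc /= expr0n addr0 sqrtr_sqr. Qed.

Lemma modc_ge0 z : 0 <= modc z.
Proof. by rewrite -rc_le -normE; exact: normr_ge0. Qed.

Lemma modc0 : modc 0 = 0. Proof. exact: Normc.normc0. Qed.
Lemma modc1 : modc 1 = 1. Proof. exact: Normc.normc1. Qed.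

Lemma modcM z w : modc (z * w) = modc z * modc w.
Proof. exact: Normc.normcM. Qed.

Lemma modcV z : modc z^-1 = (modc z)^-1.
Proof. exact: Normc.normcV. Qed.

Lemma modcX z n : modc (z ^+ n) = modc z ^+ n.
Proof. by elim: n => [|n IH]; rewrite ?expr0 ?modc1 // !exprS modcM IH. Qed.

Lemma modcN z : modc (- z) = modc z.
Proof. exact: (@normcN R z). Qed.

Lemma modcMn z n : modc (z *+ n) = modc z *+ n.
Proof. exact: (@normcMn R z). Qed.

Lemma modcB z w : modc (z - w) = modc (w - z).
Proof. by rewrite -modcN opprB. Qed.

Lemma modc_eq0 z : (modc z == 0) = (z == 0).
Proof.
apply/eqP/eqP => [|->]; last exact: modc0.
exact: Normc.eq0_normc.
Qed.

Lemma modc_gt0 z : (0 < modc z) = (z != 0).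
Proof. by rewrite lt_neqAle modc_ge0 andbT eq_sym modc_eq0. Qed.

Lemma ler_modcD z w : modc (z + w) <= modc z + modc w.
Proof. exact: (@le_normcD R z w). Qed.

Lemma ler_modcB z w : modc z - modc w <= modc (z - w).
Proof. by rewrite lerBlDr -{1}(subrK w z); exact: ler_modcD. Qed.

Lemma ler_dist_modc z w : `|modc z - modc w| <= modc (z - w).
Proof. by rewrite ler_norml ler_modcB andbT lerNl opprB modcB ler_modcB. Qed.

Lemma modc_sum (I : Type) (s : seq I) (P : pred I) (F : I -> K) :
  modc (\sum_(i <- s | P i) F i) <= \sum_(i <- s | P i) modc (F i).
Proof.
elim/big_rec2: _ => [|i x z _ IH]; first by rewrite modc0.
by apply: le_trans (ler_modcD _ _) _; rewrite lerD2l.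
Qed.

Lemma real_of_gt0 (e : K) : 0 < e -> exists2 x, 0 < x & e = rc x.
Proof.
case: e => a b; rewrite ltcE /= => /andP[/eqP -> a0].
by exists a.
Qed.

Lemma modc_lt z x : (`|z| < rc x) = (modc z < x).
Proof. by rewrite normE rc_lt. Qed.

Lemma modc_le z x : (`|z| <= rc x) = (modc z <= x).
Proof. by rewrite normE rc_le. Qed.

Lemma cvg_modcP (u : nat -> K) (l : K) :
  (u @ \oo --> l) <->
  (forall e : R, 0 < e -> \forall n \near \oo, modc (l - u n) < e).
Proof.
split=> [/cvgrPdist_lt ul e e0|ul].
  have := ul (rc e); rewrite -[0]/(rc 0) rc_lt => /(_ e0).
  by apply: filterS => n; rewrite modc_lt.
apply/cvgrPdist_lt => _ /real_of_gt0[e e0 ->].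
by apply: filterS (ul e e0) => n; rewrite modc_lt.
Qed.

Lemma ler_Re_modc z : `|complex.Re z| <= modc z.
Proof.
case: z => a b /=; rewrite -(@sqrtr_sqr R a) ler_wsqrtr // lerDl; exact: sqr_ge0.
Qed.

Lemma ler_Im_modc z : `|complex.Im z| <= modc z.
Proof.
case: z => a b /=; rewrite -(@sqrtr_sqr R b) ler_wsqrtr // lerDr; exact: sqr_ge0.
Qed.

Lemma modc_le_ReIm (a b : R) : modc (Complex a b : K) <= `|a| + `|b|.
Proof.
have -> : (Complex a b : K) = rc a + 'i%C * rc b by exact: (complexE (Complex a b)).
apply: le_trans (ler_modcD _ _) _.
by rewrite modcM !modc_rc /modc /= expr0n expr1n add0r sqrtr1 mul1r.
Qed.

Lemma ler_lim_modc (u : nat -> K) (l w : K) (B : R) :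
  u @ \oo --> l -> (\forall n \near \oo, modc (w - u n) <= B) ->
  modc (w - l) <= B.
Proof.
move=> /cvg_modcP ul uB; apply/ler_addgt0Pr => e e0.
have [n [/= n1 n2]] : exists n, modc (w - u n) <= B /\ modc (l - u n) < e.
  have /filter_ex[n []] : \forall n \near \oo, modc (w - u n) <= B /\ modc (l - u n) < e.
    by apply: filterS2 uB (ul e e0).
  by exists n.
have -> : w - l = (w - u n) + (u n - l) by ring.
apply: le_trans (ler_modcD _ _) _; rewrite [in X in _ + X]modcB.
by rewrite lerD // ltW.
Qed.

End ComplexModulus.
Arguments modc {R} z : simpl never.

(** * Power series with geometrically bounded coefficients *)

Section PowerSeries.
Variable R : realType.
Local Notation K := (C R).
Implicit Types (f g : pser R) (z w : K).

Lemma sum_geo_le (q : R) (n m : nat) : 0 <= q -> q < 1 ->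
  \sum_(n <= k < m) q ^+ k <= q ^+ n / (1 - q).
Proof.
move=> q0 q1; rewrite ler_pdivlMr ?subr_gt0 //.
have [nm|mn] := leqP n m; last by rewrite big_geq ?mul0r ?exprn_ge0 // ltnW.
have -> : (\sum_(n <= k < m) q ^+ k) * (1 - q) = q ^+ n - q ^+ m.
  rewrite big_distrl /= (@telescope_sumr_eq _ n m (fun k => - q ^+ k)) //.
    by rewrite opprK addrC.
  by move=> k _; rewrite exprS; ring.
by rewrite gerBl exprn_ge0.
Qed.

Lemma sum_nat_modc_le (u : nat -> K) (A q : R) (n m : nat) :
  0 <= q -> q < 1 -> (forall k, modc (u k) <= A * q ^+ k) -> 
  modc (\sum_(n <= k < m) u k) <= A * (q ^+ n / (1 - q)).
Proof.
move=> q0 q1 uA.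
have A0 : 0 <= A by have := le_trans (modc_ge0 _) (uA 0%N); rewrite expr0 mulr1.
apply: le_trans (modc_sum _ _ _) _.
apply: le_trans (ler_sum _ (fun k _ => uA k)) _.
by rewrite -big_distrr /= ler_wpM2l // sum_geo_le.
Qed.

Lemma cvg_real_geo_series (v : nat -> R) (A q : R) :
  0 <= q -> q < 1 -> (forall k, `|v k| <= A * q ^+ k) -> cvgn (series v).
Proof.
move=> q0 q1 vA; apply: normed_cvg.
apply: (@series_le_cvg _ _ (geometric A q)) => [n|n|n|].
- exact: normr_ge0.
- by apply: le_trans (normr_ge0 _) (vA n).
- exact: vA.
- by apply: is_cvg_geometric_series; rewrite ger0_norm.
Qed.

(** Completeness is used only over the reals: real and imaginary parts are dominated by the same
    geometric series and are summed separately. *)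
Lemma cvg_geo_series (u : nat -> K) (A q : R) :
  0 <= q -> q < 1 -> (forall k, modc (u k) <= A * q ^+ k) -> cvgn (series u).
Proof.
move=> q0 q1 uA.
have cRe : cvgn (series (fun k => complex.Re (u k))).
  by apply: cvg_real_geo_series q0 q1 _ => k; apply: le_trans (ler_Re_modc _) (uA k).
have cIm : cvgn (series (fun k => complex.Im (u k))).
  by apply: cvg_real_geo_series q0 q1 _ => k; apply: le_trans (ler_Im_modc _) (uA k).
apply/cvg_ex; exists (Complex (lim (series (fun k => complex.Re (u k)) @ \oo))
  (lim (series (fun k => complex.Im (u k)) @ \oo)) : K).
apply/cvg_modcP => e e0.
move: cRe => /cvgrPdist_lt /(_ (e / 2)); rewrite divr_gt0 // => /(_ isT) cRe.
move: cIm => /cvgrPdist_lt /(_ (e / 2)); rewrite divr_gt0 // => /(_ isT) cIm.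
apply: filterS2 cRe cIm => n hRe hIm.
have -> : series u n = Complex (series (fun k => complex.Re (u k)) n)
    (series (fun k => complex.Im (u k)) n).
  rewrite /series /=; elim: n {hRe hIm} => [|n IH]; first by rewrite !big_geq.
  by rewrite !big_nat_recr //= IH; case: (u n).
apply: le_lt_trans (modc_le_ReIm _ _) _.
by rewrite (splitr e) ltrD.
Qed.

Definition psum f z n : K := \sum_(k < n) f k * z ^+ k.

Lemma series_psum f z : series (fun k => f k * z ^+ k) = psum f z.
Proof. by apply/funext => n; rewrite /series /psum /= big_mkord. Qed.

(** Quantitative substitute for analyticity in the disc of radius [s]: it gives convergence for |z|
    < s with explicit geometric tails, and it is stable under Hadamard products, the radii being
    multiplied. *)
Definition coefs_le f (s A : R) := forall k, modc (f k) * s ^+ k <= A.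

Lemma coefs_le_term f s A z : 0 < s -> coefs_le f s A ->
  forall k, modc (f k * z ^+ k) <= A * (modc z / s) ^+ k.
Proof.
move=> s0 fA k; rewrite modcM modcX exprMn exprVn mulrA mulrAC.
by rewrite ler_wpM2r ?exprn_ge0 ?modc_ge0 // ler_pdivlMr ?exprn_gt0.
Qed.

Lemma coefs_le_ge0 f s A : coefs_le f s A -> 0 <= A.
Proof. by move=> /(_ 0%N); rewrite expr0 mulr1; apply: le_trans (modc_ge0 _). Qed.

Lemma coefs_le_pconv f s A z : coefs_le f s A -> modc z < s -> pconv f z.
Proof.
move=> fA zs; have s0 : 0 < s := le_lt_trans (modc_ge0 z) zs.
apply: (@cvg_geo_series _ A (modc z / s)); last exact: coefs_le_term.
  by rewrite divr_ge0 ?modc_ge0 ?ltW.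
by rewrite ltr_pdivrMr // mul1r.
Qed.

Lemma peval_cvg f z : pconv f z -> psum f z @ \oo --> peval f z.
Proof. by rewrite /pconv /peval series_psum. Qed.

Lemma peval_lim f z (l : K) : psum f z @ \oo --> l -> peval f z = l.
Proof. by rewrite /peval series_psum => /cvg_lim; apply. Qed.

Lemma peval_tail f s A z n : coefs_le f s A -> modc z < s ->
  modc (peval f z - psum f z n) <= A * ((modc z / s) ^+ n / (1 - modc z / s)).
Proof.
move=> fA zs; have s0 : 0 < s := le_lt_trans (modc_ge0 z) zs.
rewrite modcB; apply: ler_lim_modc (peval_cvg _) _.
  exact: coefs_le_pconv fA zs.
near=> m; have nm : (n <= m)%N by near: m; exists n.
rewrite modcB /psum -!(big_mkord xpredT (fun k => f k * z ^+ k)).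
rewrite (big_cat_nat (leq0n n) nm) //= addrAC subrr add0r.
apply: sum_nat_modc_le; last exact: coefs_le_term.
  by rewrite divr_ge0 ?modc_ge0 ?ltW.
by rewrite ltr_pdivrMr // mul1r.
Unshelve. all: by end_near. Qed.

Lemma peval_le f s A z : coefs_le f s A -> modc z < s ->
  modc (peval f z) <= A / (1 - modc z / s).
Proof.
move=> fA zs; have := peval_tail 0 fA zs.
by rewrite /psum big_ord0 subr0 expr0 mul1r.
Qed.

Lemma near_bounded (v : nat -> R) (B : R) : (\forall n \near \oo, v n <= B) ->
  exists A, forall n, v n <= A.
Proof.
case=> N _ vB; exists (`|B| + \sum_(k < N) `|v k|) => n.
have [nN|Nn] := ltnP n N.
  apply: le_trans (ler_norm _) _.
  by rewrite (bigD1 (Ordinal nN)) //= addrCA lerDl addr_ge0 // sumr_ge0.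
apply: le_trans (vB n Nn) _; apply: le_trans (ler_norm _) _.
by rewrite lerDl sumr_ge0.
Qed.

(** The terms of a convergent series tend to 0, hence are bounded. *)
Lemma pconv_coefs_le f z : pconv f z -> exists A, coefs_le f (modc z) A.
Proof.
move=> /cvg_series_cvg_0 /cvg_modcP /(_ 1 ltr01) h.
apply: (@near_bounded _ 1); apply: filterS h => k.
by rewrite sub0r modcN modcM modcX => /ltW.
Qed.

Lemma Aan_coefs_le f s : Aan f -> 0 <= s -> s < 1 -> exists A, coefs_le f s A.
Proof.
move=> fA s0 s1; have sz : `|rc s| < 1 by rewrite (modc_lt _ 1) modc_rc ger0_norm.
by have := pconv_coefs_le (fA _ sz); rewrite modc_rc ger0_norm.
Qed.

Lemma Acl_coefs_le f : Acl f -> exists s A, 1 < s /\ coefs_le f s A.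
Proof.
case=> -[a b] []; rewrite ltcE /= => /andP[/eqP -> a1] fA.
pose s := (1 + a) / 2; have s1 : 1 < s by rewrite /s; lra.
have sa : s < a by rewrite /s; lra.
have [|A hA] := @pconv_coefs_le f (rc s).
  by apply: fA; rewrite (modc_lt (rc s) a) modc_rc gtr0_norm // (lt_trans ltr01).
by exists s, A; move: hA; rewrite modc_rc gtr0_norm // (lt_trans ltr01).
Qed.

Lemma coefs_le_hadamard f g s t A B : 0 <= s -> 0 <= t ->
  coefs_le f s A -> coefs_le g t B -> coefs_le (hadamard f g) (s * t) (A * B).
Proof.
move=> s0 t0 fA gB k; rewrite /hadamard modcM exprMn mulrACA.
by rewrite ler_pM // mulr_ge0 ?modc_ge0 ?exprn_ge0.
Qed.

Lemma coefs_leB f g s A B : 0 <= s -> coefs_le f s A -> coefs_le g s B ->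
  coefs_le (fun k => f k - g k) s (A + B).
Proof.
move=> s0 fA gB k; apply: le_trans (lerD (fA k) (gB k)).
rewrite -mulrDl ler_wpM2r ?exprn_ge0 //.
by apply: le_trans (ler_modcD _ _) _; rewrite modcN.
Qed.

Lemma pevalB f g z : pconv f z -> pconv g z ->
  peval (fun k => f k - g k) z = peval f z - peval g z.
Proof.
move=> /peval_cvg fz /peval_cvg gz; apply: peval_lim.
have -> : psum (fun k => f k - g k) z = (fun n => psum f z n - psum g z n).
  apply/funext => n; rewrite /psum -sumrB.
  by apply: eq_bigr => i _; rewrite mulrBl.
exact: (cvgB fz gz).
Qed.

Lemma peval0 f : peval f 0 = f 0%N.
Proof.
apply: peval_lim; apply/cvg_modcP => e e0; exists 1%N => // -[//|n] _ /=.
rewrite /psum big_ord_recl /= expr0 mulr1 big1 ?addr0 ?subrr ?modc0 // => i _.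
by rewrite exprS mul0r mulr0.
Qed.

Lemma psum_rot f x z n : psum (Px x f) z n = psum f (x * z) n.
Proof. by apply: eq_bigr => i _; rewrite /Px exprMn mulrA. Qed.

Lemma peval_Px f x z : peval (Px x f) z = peval f (x * z).
Proof.
rewrite /peval !series_psum; congr (lim (_ @ \oo)).
by apply/funext => n; rewrite psum_rot.
Qed.

(** Coefficients of z f(z). *)
Definition shift f : pser R := fun k => if k is k'.+1 then f k' else 0.

Lemma peval_linear_mul f (a b : K) z : pconv f z ->
  peval (fun k => a * f k + b * shift f k) z = (a + b * z) * peval f z.
Proof.
move=> /[dup] fz /peval_cvg hz; apply: peval_lim.
pose g := fun k => a * f k + b * shift f k.
(* The partial sums match up to one boundary term, a multiple of the general term of a convergent
   series, which vanishes in the limit. *)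
have E n : psum g z n.+1 = (a + b * z) * psum f z n + a * (f n * z ^+ n).
  elim: n => [|n IH].
    by rewrite /psum !big_ord_recl !big_ord0 /= /g /=; ring.
  by rewrite {1}/psum big_ord_recr -/(psum g z n.+1) /= IH /psum big_ord_recr /= /g /= exprS; ring.
rewrite -(cvg_shiftS (psum g z)) (_ : (fun n => _) = 
   (fun n => (a + b * z) * psum f z n + a * (f n * z ^+ n))); last first.
  by apply/funext => n; exact: E.
have -> : (a + b * z) * peval f z = (a + b * z) * peval f z + a * 0.
  by rewrite mulr0 addr0.
have fz0 := cvg_series_cvg_0 fz.
have h1 := @cvgMl_tmp K _ _ _ _ (a + b * z) _ hz.
have h2 := @cvgMl_tmp K _ _ _ _ a _ fz0.
exact: (cvgD (h1 _) (h2 _)).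
Qed.

End PowerSeries.

(** * Lipschitz estimates and finite order of zeros *)

Section Zeros.
Variable R : realType.
Local Notation K := (C R).
Implicit Types (f g : pser R) (z w : K).

(** Division of f by z - z0. The coefficients of the quotient are partial sums of f at z0 divided by
    powers of z0; as f(z0) = 0, each partial sum is minus a tail, whose geometric decay preserves
    the radius [s]. *)
Lemma peval_factor f (s A : R) z0 : z0 != 0 -> modc z0 < s -> coefs_le f s A ->
  peval f z0 = 0 ->
  exists g B, coefs_le g s B /\ f = (fun k => - z0 * g k + 1 * shift g k).
Proof.
move=> z0n z0s fA f0; have s0 : 0 < s := le_lt_trans (modc_ge0 z0) z0s.
exists (fun k => - psum f z0 k.+1 / z0 ^+ k.+1), (A / (s - modc z0)); split.
  move=> k; rewrite modcM modcN modcV modcX.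
  have := peval_tail k.+1 fA z0s; rewrite f0 sub0r modcN => h.
  have m0 : 0 < modc z0 by rewrite modc_gt0.
  rewrite mulrAC ler_pdivrMr ?exprn_gt0 //.
  apply: le_trans (ler_wpM2r _ h) _; first by rewrite exprn_ge0 // ltW.
  have sz : s - modc z0 != 0 by rewrite subr_eq0 gt_eqF.
  rewrite exprMn exprVn le_eqVlt; apply/orP; left; apply/eqP.
  rewrite [s ^+ k.+1]exprS; field.
  by rewrite sz lt0r_neq0 // lt0r_neq0 // exprn_gt0.
apply/funext => -[|k] /=.
  by rewrite /psum big_ord_recl big_ord0 /= expr1; field.
rewrite [psum f z0 k.+2]/psum big_ord_recr -/(psum f z0 k.+1) /= ![z0 ^+ k.+2]exprS.
by field; rewrite expf_neq0.
Qed.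

(** Each of x, ..., x^k is at least x^k, and their sum is bounded by the geometric series. *)
Lemma nat_mul_expr_le (x : R) k : 0 <= x -> x < 1 -> k%:R * x ^+ k <= (1 - x)^-1.
Proof.
move=> x0 x1; have := sum_geo_le 1 k.+1 x0 x1; rewrite expr1 => h.
have {h} h : \sum_(1 <= i < k.+1) x ^+ i <= (1 - x)^-1.
  by apply: le_trans h _; rewrite ler_piMl // ?invr_ge0 ?subr_ge0 ltW.
apply: le_trans h.
have -> : k%:R * x ^+ k = \sum_(1 <= i < k.+1) x ^+ k.
  by rewrite sumr_const_nat subn1 mulr_natl.
rewrite big_nat_cond [X in _ <= X]big_nat_cond; apply: ler_sum => i.
by rewrite andbT => /andP[_ ik]; rewrite ler_wiXn2l // ltW.
Qed.

Lemma modc_exprB_le z w (r : R) k : modc z <= r -> modc w <= r ->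
  modc (z ^+ k.+1 - w ^+ k.+1) <= modc (z - w) * (k.+1%:R * r ^+ k).
Proof.
move=> zr wr; rewrite subrXX modcM ler_wpM2l ?modc_ge0 //.
apply: le_trans (modc_sum _ _ _) _.
have -> : k.+1%:R * r ^+ k = \sum_(i < k.+1) r ^+ k.
  by rewrite sumr_const card_ord mulr_natl.
apply: ler_sum => i _.
have -> : r ^+ k = r ^+ (k.+1.-1 - i) * r ^+ i.
  by rewrite -exprD subnK // -ltnS.
have r0 : 0 <= r := le_trans (modc_ge0 z) zr.
rewrite modcM !modcX ler_pM ?exprn_ge0 ?modc_ge0 // lerXn2r ?nnegrE ?modc_ge0 //.
Qed.

(** The difference z^k - w^k costs a factor k r^(k-1). With r < t < s, the powers of t/s absorb k
    and those of r/t keep the series summable. *)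
Lemma peval_lipschitz f (s A r : R) : coefs_le f s A -> 0 < r -> r < s ->
  exists2 L, 0 <= L & forall z w, modc z <= r -> modc w <= r ->
    modc (peval f z - peval f w) <= L * modc (z - w).
Proof.
move=> fA r0 rs; have [t rt ts] : exists2 t, r < t & t < s.
  by exists ((r + s) / 2); lra.
have t0 : 0 < t := lt_trans r0 rt.
have s0 : 0 < s := lt_trans t0 ts.
have A0 := coefs_le_ge0 fA.
have ts1 : t / s < 1 by rewrite ltr_pdivrMr // mul1r.
have rt1 : r / t < 1 by rewrite ltr_pdivrMr // mul1r.
have ts0 : 0 <= t / s by rewrite divr_ge0 // ltW.
have rt0 : 0 <= r / t by rewrite divr_ge0 // ltW.
pose M := A / r / (1 - t / s).
have M0 : 0 <= M by rewrite !divr_ge0 // ?subr_ge0 ltW.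
exists (M / (1 - r / t)); first by rewrite divr_ge0 // subr_ge0 ltW.
move=> z w zr wr.
have term k : modc (f k * z ^+ k - f k * w ^+ k) <= M * modc (z - w) * (r / t) ^+ k.
  case: k => [|k].
    by rewrite !expr0 subrr modc0 mulr1 mulr_ge0 // modc_ge0.
  rewrite -mulrBr modcM.
  have h1 := modc_exprB_le k zr wr.
  have h2 := nat_mul_expr_le k.+1 ts0 ts1.
  have h3 := fA k.+1.
  have {h3} h3 : modc (f k.+1) <= A / s ^+ k.+1 by rewrite ler_pdivlMr ?exprn_gt0.
  apply: le_trans (ler_pM (modc_ge0 _) (modc_ge0 _) h3 h1) _.
  have -> : A / s ^+ k.+1 * (modc (z - w) * (k.+1%:R * r ^+ k)) =
    A / r * modc (z - w) * (r / t) ^+ k.+1 * (k.+1%:R * (t / s) ^+ k.+1).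
    rewrite !exprMn !exprVn [r ^+ k.+1]exprS.
    have : s ^+ k.+1 != 0 by rewrite lt0r_neq0 ?exprn_gt0.
    have : t ^+ k.+1 != 0 by rewrite lt0r_neq0 ?exprn_gt0.
    have := lt0r_neq0 r0.
    move: (s ^+ _) (t ^+ _) (r ^+ k) (k.+1%:R) => s' t' r' k' rn tn sn.
    by field; rewrite rn tn sn.
  have -> : M * modc (z - w) * (r / t) ^+ k.+1 = 
     A / r * modc (z - w) * (r / t) ^+ k.+1 * (1 - t / s)^-1 by rewrite /M; ring.
  apply: ler_wpM2l h2.
  by rewrite mulr_ge0 ?exprn_ge0 // mulr_ge0 ?modc_ge0 // divr_ge0 // ltW.
have psumB n : modc (psum f z n - psum f w n) <= M / (1 - r / t) * modc (z - w).
  rewrite /psum -sumrB -(big_mkord xpredT (fun k => f k * z ^+ k - f k * w ^+ k)).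
  apply: le_trans (sum_nat_modc_le _ _ rt0 rt1 term) _.
  by rewrite expr0 mul1r mulrAC.
rewrite -modcN -sub0r.
have h : (fun n => psum f z n - psum f w n) @ \oo --> peval f z - peval f w.
  have hz := peval_cvg (coefs_le_pconv fA (le_lt_trans zr rs)).
  have hw := peval_cvg (coefs_le_pconv fA (le_lt_trans wr rs)).
  exact: (cvgB hz hw).
apply: (ler_lim_modc h); near=> n; rewrite sub0r modcN; exact: psumB.
Unshelve. all: by end_near. Qed.

Lemma modc_sqr z : modc z ^+ 2 = complex.Re z ^+ 2 + complex.Im z ^+ 2.
Proof. by case: z => a b; rewrite /modc /= sqr_sqrtr // addr_ge0 // sqr_ge0. Qed.

Lemma modc_conjc z : modc (conjc z) = modc z.
Proof. by case: z => a b; rewrite /modc /= sqrrN. Qed.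

(** Coefficientwise form of the fact that |1 - conj(z) u| = |u - z| when |u| = 1: the two sides
    agree up to a difference that telescopes along the coefficients. *)
Lemma blaschke_sqr z x y :
  modc (1 * y + - conjc z * x) ^+ 2 - modc (- z * y + 1 * x) ^+ 2 =
  (1 - modc z ^+ 2) * (modc y ^+ 2 - modc x ^+ 2).
Proof.
by rewrite !modc_sqr; case: z => a b; case: x => c d; case: y => e g /=; ring.
Qed.

Lemma blaschke_sum z g n :
  \sum_(k < n.+1) modc (1 * g k + - conjc z * shift g k) ^+ 2 =
  \sum_(k < n.+1) modc (- z * g k + 1 * shift g k) ^+ 2
    + (1 - modc z ^+ 2) * modc (g n) ^+ 2.
Proof.
elim: n => [|n IH].
  rewrite !big_ord_recl !big_ord0 !addr0 /=.
  have := blaschke_sqr z 0 (g 0%N); rewrite modc0 => h; lra.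
rewrite big_ord_recr IH [in RHS]big_ord_recr /=.
have := blaschke_sqr z (g n) (g n.+1); lra.
Qed.

#[local] Opaque peval modc.

Lemma half_le_of_lipschitz (L a b c : R) : 0 <= L -> 0 <= a -> b - c <= L * a ->
  a * (2 * (L + 1)) < b -> b / 2 <= c.
Proof. move=> L0 a0 h1 h2; lra. Qed.

Lemma half_mul_le (a b c x y : R) : 0 <= x -> 0 <= b -> y <= 2 -> c * a <= y * x ->
  c / 2 * (b * a) <= b * x.
Proof.
move=> x0 b0 y2 h; rewrite mulrCA ler_wpM2l //.
have := ler_wpM2r x0 y2; lra.
Qed.

Lemma coefs_le_linear_shift g (s B : R) (a b : K) : 0 <= s -> coefs_le g s B ->
  coefs_le (fun k => a * g k + b * shift g k) s (modc a * B + modc b * (s * B)).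
Proof.
move=> s0 gB k; have B0 := coefs_le_ge0 gB.
apply: (@le_trans _ _ ((modc a * modc (g k) + modc b * modc (shift g k)) * s ^+ k)).
  by rewrite ler_wpM2r ?exprn_ge0 // -!modcM ler_modcD.
rewrite mulrDl -!mulrA; apply: lerD; apply: ler_wpM2l; rewrite ?modc_ge0 //.
case: k => [|k] /=; first by rewrite modc0 mul0r mulr_ge0.
by rewrite exprS mulrCA ler_wpM2l.
Qed.

(* Multiplying by the Blaschke factor (1 - z0^* z) / (z - z0) preserves the l^2 norm
   of the coefficients and multiplies |f(0)| by 1 / |z0|, which bounds the
   multiplicity of the zero z0. *)
Lemma zero_order_aux (s : R) z0 (B : R) n f A : 1 < s -> 0 < modc z0 -> modc z0 < 1 ->
  coefs_le f s A -> (forall N, \sum_(k < N) modc (f k) ^+ 2 <= B) ->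
  B * (modc z0 ^+ 2) ^+ n < modc (f 0%N) ^+ 2 ->
  exists m c d, [/\ 0 < c, 0 < d & forall z, modc (z - z0) < d ->
    c * modc (z - z0) ^+ m <= modc (peval f z)].
Proof.
move=> s1 z00 z01; elim: n f A => [|n IH] f A fA fB nB.
  (* For n = 0 the hypothesis puts |f(0)|^2 above the bound of the l^2 sums, whose first term it is:
     a contradiction. *)
  have := fB 1%N; rewrite big_ord_recl big_ord0 addr0 leNgt.
  by move: nB; rewrite expr0 mulr1 => ->.
have s0 : 0 < s := lt_trans ltr01 s1.
have near_in z : modc (z - z0) < 1 - modc z0 -> modc z < 1.
  by move=> zd; have := ler_modcB z z0; lra.
(* If f(z0) is not 0, the exponent 0 suffices: Lipschitz continuity keeps |f| above half of |f(z0)|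
   near z0. *)
have [fz0|fz0] := eqVneq (peval f z0) 0; last first.
  have [L L0 lipL] := peval_lipschitz fA ltr01 s1.
  have fz00 : 0 < modc (peval f z0) by rewrite modc_gt0.
  have L10 : 0 < 2 * (L + 1) by lra.
  exists 0%N, (modc (peval f z0) / 2),
    (Num.min (1 - modc z0) (modc (peval f z0) / (2 * (L + 1)))); split.
  - by rewrite divr_gt0.
  - by rewrite lt_min subr_gt0 z01 divr_gt0.
  move=> z; rewrite lt_min => /andP[/near_in z1]; rewrite (ltr_pdivlMr _ _ L10) => zd.
  have h1 := ler_modcB (peval f z0) (peval f z).
  rewrite (modcB (peval f z0) (peval f z)) in h1.
  have h2 := le_trans h1 (lipL z z0 (ltW z1) (ltW z01)).
  rewrite expr0 mulr1; exact: half_le_of_lipschitz L0 (modc_ge0 _) h2 zd.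
have z0n : z0 != 0 by rewrite -modc_gt0.
have [g [A' [gA fE]]] := peval_factor z0n (lt_trans z01 s1) fA fz0.
(* With f = (z - z0) g, this is (1 - conj(z0) z) g, that is f divided by the Blaschke factor. *)
pose h : pser R := fun k => 1 * g k + - conjc z0 * shift g k.
have [||m [c [d [c0 d0 hm]]]] := IH h _ (coefs_le_linear_shift _ _ (ltW s0) gA).
- move=> N; apply/ler_addgt0Pr => e e0.
  have g1 : pconv g 1 by apply: (coefs_le_pconv gA); rewrite modc1.
  (* The boundary term of [blaschke_sum] is at most |g_M|^2 for the last index M. Since g_k tends to
     0, M is taken with |g_M| < 1 and |g_M| < e, so that |g_M|^2 <= |g_M| < e. *)
  have e10 : 0 < Num.min 1 e by rewrite lt_min ltr01.
  have /cvg_modcP /(_ _ e10) [M _ hM] := cvg_series_cvg_0 g1.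
  have := hM (maxn M N) (leq_maxl _ _).
  rewrite /= sub0r modcN expr1n mulr1 lt_min => /andP[gM1 gMe].
  apply: (@le_trans _ _ (\sum_(k < (maxn M N).+1) modc (h k) ^+ 2)).
    rewrite -!(big_mkord xpredT (fun k => modc (h k) ^+ 2)).
    rewrite (@big_cat_nat _ _ _ N 0 (maxn M N).+1) //=; last first.
      by rewrite leqW // leq_maxr.
    by rewrite lerDl sumr_ge0 // => i _; rewrite sqr_ge0.
  rewrite blaschke_sum; have := fB (maxn M N).+1; rewrite fE.
  move=> hB; apply: lerD => //; apply: le_trans (ltW gMe).
  have g0 := modc_ge0 (g (maxn M N)).
  apply: (@le_trans _ _ (1 * modc (g (maxn M N)) ^+ 2)).
    by rewrite ler_wpM2r ?sqr_ge0 // gerBl sqr_ge0.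
  by rewrite mul1r expr2 ler_piMl // ltW.
(* |h(0)| = |g(0)| = |f(0)| / |z0|, so one factor |z0|^2 cancels and n drops by one. *)
- move: nB; rewrite fE /h /= !mulr0 !addr0 mul1r modcM modcN.
  have -> : (modc z0 * modc (g 0%N)) ^+ 2 = modc z0 ^+ 2 * modc (g 0%N) ^+ 2 by ring.
  have : 0 < modc z0 ^+ 2 by rewrite exprn_gt0.
  by move: (modc z0 ^+ 2) => x x0; rewrite exprS mulrCA ltr_pM2l.
exists m.+1, (c / 2), (Num.min (1 - modc z0) d); split.
- by rewrite divr_gt0.
- by rewrite lt_min subr_gt0 z01.
move=> z; rewrite lt_min => /andP[/near_in z1 /hm].
have gz : pconv g z by apply: (coefs_le_pconv gA); exact: lt_trans s1.
rewrite /h peval_linear_mul // fE peval_linear_mul // !modcM mul1r addrC.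
have -> : - z0 + z = z - z0 by rewrite addrC.
move=> hz; rewrite exprS.
(* This is where the constant c/2 comes from: passing from h back to g loses a factor of at most
   2. *)
have : modc (1 + - conjc z0 * z) <= 2.
  apply: le_trans (ler_modcD _ _) _; rewrite modcM modcN modc_conjc modc1.
  by rewrite -[2]/(1 + 1) lerD2l mulr_ile1 ?modc_ge0 // ltW.
have := modc_ge0 (z - z0); have := modc_ge0 (peval g z).
move=> x0 b0 y2; exact: half_mul_le x0 b0 y2 hz.
Qed.

(** The squares of the coefficients are dominated by a geometric series of ratio 1/s^2, which gives
    an l^2 bound B; since |z0| < 1, some n makes B |z0|^(2n) smaller than |f(0)|^2. *)
Lemma zero_order f (s A : R) z0 : 1 < s -> coefs_le f s A -> 0 < modc z0 ->
  modc z0 < 1 -> f 0%N != 0 ->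
  exists m c d, [/\ 0 < c, 0 < d & forall z, modc (z - z0) < d ->
    c * modc (z - z0) ^+ m <= modc (peval f z)].
Proof.
move=> s1 fA z00 z01 f0; have s0 : 0 < s := lt_trans ltr01 s1.
pose q := (s ^+ 2)^-1.
have q0 : 0 <= q by rewrite invr_ge0 sqr_ge0.
have q1 : q < 1 by rewrite invf_lt1 ?exprn_gt0 // exprn_egt1.
pose B := A ^+ 2 / (1 - q).
have fB N : \sum_(k < N) modc (f k) ^+ 2 <= B.
  apply: (@le_trans _ _ (\sum_(k < N) A ^+ 2 * q ^+ k)).
    apply: ler_sum => k _; rewrite /q exprVn ler_pdivlMr ?exprn_gt0 //.
    rewrite exprAC -exprMn lerXn2r ?nnegrE ?mulr_ge0 ?modc_ge0 ?exprn_ge0 ?(coefs_le_ge0 fA) // ltW //.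
  rewrite -big_distrr /= -(big_mkord xpredT (fun k => q ^+ k)) ler_wpM2l ?sqr_ge0 //.
  by have := sum_geo_le 0 N q0 q1; rewrite expr0 mul1r.
have B0 : 0 <= B by have := fB 0%N; rewrite big_ord0.
have f00 : 0 < modc (f 0%N) ^+ 2 by rewrite exprn_gt0 // modc_gt0.
have x1 : modc z0 ^+ 2 < 1 by rewrite exprn_ilt1 ?ltW.
have := @cvg_expr R (modc z0 ^+ 2); rewrite ger0_norm ?sqr_ge0 // => /(_ x1).
move=> /cvgrPdist_lt /(_ (modc (f 0%N) ^+ 2 / (B + 1))).
rewrite divr_gt0 // ?ltr_wpDl // => /(_ isT) [n _ /(_ n (leqnn n))] /=.
have xn0 : 0 <= (modc z0 ^+ 2) ^+ n by rewrite exprn_ge0 ?sqr_ge0.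
rewrite sub0r normrN ger0_norm // ltr_pdivlMr ?ltr_wpDl // => h.
apply: (@zero_order_aux s z0 B n f A) => //; apply: le_lt_trans h.
by rewrite mulrDr mulr1 mulrC lerDl.
Qed.

End Zeros.

(** * Polynomials on the unit circle: Cauchy's estimate and the minimum principle *)

Section Circle.
Variable R : realType.
Local Notation K := (C R).
Implicit Types (p q : {poly K}) (z w : K).
#[local] Opaque peval modc.

Lemma prod_const_seq (S : comPzRingType) (I : Type) (s : seq I) (x : S) :
  \prod_(i <- s) x = x ^+ size s.
Proof. by elim: s => [|i s IH]; rewrite ?big_nil // big_cons IH exprS. Qed.

Lemma modc_prod (I : Type) (s : seq I) (F : I -> K) :
  modc (\prod_(i <- s) F i) = \prod_(i <- s) modc (F i).
Proof. exact: (big_morph _ (@modcM R) (@modc1 R)). Qed.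

Lemma modc_expr_eq1 z n : (0 < n)%N -> modc (z ^+ n) = 1 -> modc z = 1.
Proof.
by move=> n0; rewrite modcX => /eqP; rewrite pexpr_eq1 ?modc_ge0 // => /eqP.
Qed.

Lemma modc_half (a b : K) (e : R) : modc (a + b) <= e -> modc (a - b) <= e ->
  modc a <= e.
Proof.
move=> h1 h2; have := le_trans (ler_modcD (a + b) (a - b)) (lerD h1 h2).
have -> : a + b + (a - b) = a *+ 2 by ring.
by rewrite modcMn; lra.
Qed.

(* Cauchy's estimate. On the unit circle the even and odd parts of p are, up to
   a unimodular factor, polynomials in z^2 bounded by the same constant. *)
Lemma coef_le_circle p (e : R) : (forall z, modc z = 1 -> modc p.[z] <= e) ->
  forall k, modc p`_k <= e.
Proof.
have [n] := ubnP (size p); elim: n p => // n IH p pn pe k.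
have e0 : 0 <= e by apply: le_trans (modc_ge0 _) (pe 1 (modc1 _)).
have [p1|p2] := leqP (size p) 1.
  have [c pc] : exists c, p = c%:P by exists p`_0; exact: size1_polyC.
  move: (pe 1 (modc1 _)); rewrite pc hornerC coefC.
  by case: eqP => // _; rewrite modc0.
have evenodd z : p.[z] = (even_poly p).[z ^+ 2] + (odd_poly p).[z ^+ 2] * z.
  by rewrite -{1}(poly_even_odd p) hornerD hornerMX !horner_comp hornerXn.
have bnd z : modc z = 1 ->
  modc (even_poly p).[z ^+ 2] <= e /\ modc (odd_poly p).[z ^+ 2] <= e.
  move=> z1; have h1 := pe z z1.
  have h2 : modc p.[- z] <= e by apply: pe; rewrite modcN.
  rewrite evenodd in h1; rewrite evenodd sqrrN mulrN in h2.
  split; first exact: modc_half h1 h2.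
  rewrite -[modc _]mulr1 -z1 -modcM; apply: (@modc_half _ ((even_poly p).[z ^+ 2])).
    by rewrite addrC.
  by rewrite -modcN opprB.
(* Squaring maps the unit circle onto itself, so the bounds at z^2 are bounds on the whole circle
   and induction on the size applies. *)
have sq w : modc w = 1 -> exists2 z, modc z = 1 & w = z ^+ 2.
  move=> w1; exists (sqrtC w); last by rewrite sqrtCK.
  by apply: (@modc_expr_eq1 _ 2) => //; rewrite sqrtCK.
rewrite -(odd_double_half k); case: (odd k) => /=.
  rewrite add1n -coef_odd_poly; apply: IH => [|w /sq[z /bnd[_ h] ->] //].
  by apply: leq_ltn_trans (size_odd_poly _) _; lia.
rewrite add0n -coef_even_poly; apply: IH => [|w /sq[z /bnd[h _] ->] //].
by apply: leq_ltn_trans (size_even_poly _) _; rewrite uphalfE; lia.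
Qed.

(** Constants disappear under n-th roots: if a < m, then (a/m)^n tends to 0 and falls below 1/c. *)
Lemma le_of_exprn_le (a m c : R) : 0 <= a -> 0 < c ->
  (forall n, (0 < n)%N -> m ^+ n <= c * a ^+ n) -> m <= a.
Proof.
move=> a0 c0 h; rewrite leNgt; apply/negP => am.
have m0 : 0 < m := le_lt_trans a0 am.
have x1 : a / m < 1 by rewrite ltr_pdivrMr // mul1r.
have x0 : 0 <= a / m by rewrite divr_ge0 // ltW.
have := @cvg_expr R (a / m); rewrite ger0_norm // => /(_ x1).
move=> /cvgrPdist_lt /(_ c^-1); rewrite invr_gt0 => /(_ c0) [n _].
move=> /(_ n.+1 (leqnSn n)) /=; have xn0 : 0 <= (a / m) ^+ n.+1 by rewrite exprn_ge0.
rewrite sub0r normrN ger0_norm // exprMn exprVn ltr_pdivrMr ?exprn_gt0 //.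
by rewrite mulrC ltr_pdivlMr // mulrC ltNge h.
Qed.

Lemma poly_min_principle q (m : R) : (forall z, modc z < 1 -> q.[z] != 0) ->
  (forall z, modc z = 1 -> m <= modc q.[z]) -> m <= modc q.[0].
Proof.
(* Lower bounds can be multiplied only for m >= 0; a negative m is trivial. *)
move=> q0 qm; have [m0|m0] := ltP m 0; first by rewrite ltW // (lt_le_trans m0) ?modc_ge0.
have [rs qE] := closed_field_poly_normal q.
have lc0 : lead_coef q != 0.
  rewrite lead_coef_eq0; apply/eqP => q00.
  by have := q0 0; rewrite modc0 q00 horner0 eqxx => /(_ ltr01).
have qz z : q.[z] = lead_coef q * \prod_(b <- rs) (z - b).
  rewrite {1}qE hornerZ horner_prod; congr (_ * _).
  by apply: eq_bigr => b _; rewrite hornerXsubC.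
have rs1 b : b \in rs -> 1 <= modc b.
  move=> brs; rewrite leNgt; apply/negP => /q0 /negP; apply.
  by rewrite qz (big_rem b) //= subrr mul0r mulr0.
apply: (@le_of_exprn_le _ _ (2 ^+ size rs)); rewrite ?modc_ge0 ?exprn_gt0 // => n n0.
have [us usE] := closed_field_poly_normal ('X^n - 1%:P : {poly K}).
rewrite (monicP (monic_Xn_sub_1 _ n0)) scale1r in usE.
have sus : size us = n.
  by apply: succn_inj; rewrite -(size_XnsubC (1 : K) n0) usE size_prod_XsubC.
have us1 u : u \in us -> modc u = 1.
  move=> uus; apply: (modc_expr_eq1 n0).
  suff -> : u ^+ n = 1 by exact: modc1.
  apply/eqP; rewrite -subr_eq0; have : ('X^n - 1%:P : {poly K}).[u] = 0.
    by rewrite usE horner_prod (big_rem u) //= hornerXsubC subrr mul0r.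
  by rewrite hornerD hornerN hornerC hornerXn => ->.
have produs b : modc (\prod_(u <- us) (u - b)) = modc (b ^+ n - 1).
  have -> : b ^+ n - 1 = \prod_(u <- us) (b - u).
    have := congr1 (horner^~ b) usE; rewrite hornerD hornerN hornerC hornerXn => ->.
    by rewrite horner_prod; apply: eq_bigr => u _; rewrite hornerXsubC.
  by rewrite !modc_prod; apply: eq_bigr => u _; rewrite modcB.
apply: (@le_trans _ _ (\prod_(u <- us) modc q.[u])).
  rewrite -sus -prod_const_seq big_seq [X in _ <= X]big_seq.
  by apply: ler_prod => u uus; rewrite m0 qm // us1.
rewrite -modc_prod (eq_bigr _ (fun u _ => qz u)) big_split /=.
rewrite exchange_big /= prod_const_seq sus modcM modc_prod.
rewrite (eq_bigr _ (fun b _ => produs b)).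
apply: (@le_trans _ _ (modc (lead_coef q ^+ n) * \prod_(b <- rs) (2 * modc b ^+ n))).
  rewrite ler_wpM2l ?modc_ge0 // big_seq [X in _ <= X]big_seq.
  apply: ler_prod => b brs; rewrite modc_ge0 /=.
  apply: le_trans (ler_modcD _ _) _; rewrite modcN modc1 modcX.
  by have := exprn_ege1 n (rs1 b brs); lra.
rewrite big_split /= prod_const_seq qz modcM modc_prod modcX exprMn.
have -> : \prod_(b <- rs) modc (0 - b) = \prod_(b <- rs) modc b.
  by apply: eq_bigr => b _; rewrite sub0r modcN.
by rewrite -prodrXl mulrCA.
Qed.

End Circle.

(** * Minimum principle for power series and Hurwitz's theorem *)

Section Hurwitz.
Variable R : realType.
Local Notation K := (C R).
Implicit Types (f g h : pser R) (z w : K).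
#[local] Opaque peval modc.

(** The condition k < n lets a caller keep the k-th coefficient in the truncation. *)
Lemma peval_unif_trunc f (s A r e : R) k : coefs_le f s A -> 0 <= r -> r < s -> 0 < e ->
  exists2 n, (k < n)%N &
    forall z, modc z <= r -> modc (peval f z - psum f z n) <= e.
Proof.
move=> fA r0 rs e0; have s0 : 0 < s := le_lt_trans r0 rs.
have A0 := coefs_le_ge0 fA.
have q1 : r / s < 1 by rewrite ltr_pdivrMr // mul1r.
have q0 : 0 <= r / s by rewrite divr_ge0 // ltW.
(* The tail is at most A (r/s)^n / (1 - r/s); dividing by A + 1 instead of A covers A = 0. *)
have d0 : 0 < e * (1 - r / s) / (A + 1).
  by rewrite divr_gt0 ?mulr_gt0 ?subr_gt0 // ltr_wpDl.
have := @cvg_expr R (r / s); rewrite ger0_norm // => /(_ q1).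
move=> /cvgrPdist_lt /(_ _ d0) [N _ hN].
exists (maxn N k.+1); first exact: leq_maxr.
move=> z zr; have := hN _ (leq_maxl N k.+1).
set n := maxn _ _; rewrite /= sub0r normrN ger0_norm ?exprn_ge0 // => qn.
apply: le_trans (peval_tail n fA (le_lt_trans zr rs)) _.
have zs : modc z / s <= r / s by rewrite ler_pM2r ?invr_gt0.
have zs0 : 0 <= modc z / s by rewrite divr_ge0 ?modc_ge0 // ltW.
apply: (@le_trans _ _ (A * ((r / s) ^+ n / (1 - r / s)))).
  apply: ler_wpM2l => //; apply: ler_pM; rewrite ?exprn_ge0 ?invr_ge0 ?subr_ge0 //.
  - by rewrite (le_trans zs) // ltW.
  - by rewrite lerXn2r.
  - by rewrite lef_pV2 ?posrE ?subr_gt0 ?(le_lt_trans zs) // lerB.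
rewrite mulrA ler_pdivrMr ?subr_gt0 //.
move: qn; rewrite ltr_pdivlMr ?ltr_wpDl // => /ltW; apply: le_trans.
by rewrite mulrDr mulr1 mulrC lerDl exprn_ge0.
Qed.

Lemma psum_horner f (a : K) z n :
  psum f (a * z) n = (\poly_(i < n) (f i * a ^+ i)).[z].
Proof.
by rewrite horner_poly; apply: eq_bigr => i _; rewrite exprMn mulrA.
Qed.

(** Cauchy's estimate for series: truncate with error d, rescale the circle of radius r to the unit
    circle, apply [coef_le_circle] with e + d, and let d tend to 0. *)
Lemma peval_coef_le f (s A r e : R) : coefs_le f s A -> 0 <= r -> r < s ->
  (forall z, modc z = r -> modc (peval f z) <= e) -> coefs_le f r e.
Proof.
move=> fA r0 rs fe k; apply/ler_addgt0Pr => d d0.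
have [n kn hn2] := peval_unif_trunc k fA r0 rs d0.
have mr : modc (rc r) = r by rewrite modc_rc ger0_norm.
have := @coef_le_circle R (\poly_(i < n) (f i * rc r ^+ i)) (e + d) _ k.
rewrite coef_poly kn modcM modcX mr; apply => z z1.
rewrite -psum_horner.
have zr : modc (rc r * z) = r by rewrite modcM mr z1 mulr1.
have h1 := fe _ zr; have hn : modc (rc r * z) <= r by rewrite zr.
rewrite -(subKr (peval f (rc r * z)) (psum _ _ _)).
apply: le_trans (ler_modcD _ _) _; rewrite modcN; exact: lerD h1 (hn2 _ hn).
Qed.

Lemma continuous_modc_peval f (s A : R) (p : R * R) : 1 < s -> coefs_le f s A ->
  modc (Complex p.1 p.2 : K) < 1 ->
  {for p, continuous (fun q : R * R => modc (peval f (Complex q.1 q.2 : K)))}.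
Proof.
move=> s1 fA p1.
have [L L0 lipL] := peval_lipschitz fA ltr01 s1.
apply/cvgrPdist_lt => e e0; apply/(@nbhs_ballP R (R * R)%type).
pose d := Num.min ((1 - modc (Complex p.1 p.2 : K)) / 2) (e / (2 * (L + 1))).
have L1 : 0 < 2 * (L + 1) by rewrite mulr_gt0 // ltr_wpDl.
have d0 : 0 < d by rewrite lt_min !divr_gt0 // subr_gt0.
exists d => //= q [/= h1 h2].
have hpq : modc (Complex p.1 p.2 - Complex q.1 q.2 : K) < 2 * d.
  apply: le_lt_trans (modc_le_ReIm (p.1 - q.1) (p.2 - q.2)) _.
  by rewrite mulr_natl mulr2n ltrD.
apply: le_lt_trans (ler_dist_modc _ _) _.
have q1 : modc (Complex q.1 q.2 : K) <= 1.
  have := ler_modcB (Complex q.1 q.2 : K) (Complex p.1 p.2 : K).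
  rewrite (modcB (Complex q.1 q.2 : K)).
  have : 2 * d <= 1 - modc (Complex p.1 p.2 : K).
    by rewrite mulrC -ler_pdivlMr // ge_min lexx.
  move: hpq; move: (modc _) (modc _) (modc _) => a b c; clear; lra.
apply: le_lt_trans (lipL _ _ (ltW p1) q1) _.
apply: (@le_lt_trans _ _ (L * (2 * d))); first by rewrite ler_wpM2l // ltW.
have : d <= e / (2 * (L + 1)) by rewrite ge_min lexx orbT.
rewrite ler_pdivlMr //; clear -L0 e0 d0; move: d d0 => d d0; lra.
Qed.

(** The minimum is taken over the compact square of half-side d about z0, a product of real
    segments. It contains the closed disc of radius d, and its points lie within 2d of z0, hence in
    the unit disc. *)
Lemma peval_square_min f (s A : R) z0 (d : R) : 1 < s -> coefs_le f s A ->
  0 < d -> modc z0 + 2 * d < 1 -> (forall z, modc z <= 1 -> peval f z != 0) ->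
  exists2 mu, 0 < mu & forall z, modc (z - z0) <= d -> mu <= modc (peval f z).
Proof.
move=> s1 fA d0 zd1 fn0; case: z0 zd1 => x0 y0 zd1.
pose S : set (R * R) := `[x0 - d, x0 + d] `*` `[y0 - d, y0 + d].
have SP (x y : R) : S (x, y) <-> `|x - x0| <= d /\ `|y - y0| <= d.
  by rewrite /S /= !in_itv /= -!ler_distlC !(distrC x0) !(distrC y0); split => -[].
have S1 p : S p -> modc (Complex p.1 p.2 : K) < 1.
  case: p => x y /SP[h1 h2]; have := ler_modcB (Complex x y : K) (Complex x0 y0 : K).
  have := modc_le_ReIm (x - x0) (y - y0); rewrite -/(Complex x y - Complex x0 y0) /=.
  move: zd1 h1 h2; rewrite -[Complex (x - x0) (y - y0)]/(Complex x y - Complex x0 y0 : K).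
  move: (modc _) (modc _) (modc _) `|_| `|_| => a b c u v; clear; lra.
have S0 : S !=set0 by exists (x0, y0); apply/SP; rewrite !subrr normr0 ltW.
have Sc : compact S by apply: compact_setX; exact: segment_compact.
have [|p pS pmin] := compact_EVT_min S0 Sc
    (f := fun q : R * R => modc (peval f (Complex q.1 q.2 : K))).
  apply: continuous_in_subspaceT => p /set_mem /S1 p1.
  exact: continuous_modc_peval s1 fA p1.
exists (modc (peval f (Complex p.1 p.2 : K))).
  by rewrite modc_gt0 fn0 // ltW // S1 // -in_setE.
move=> [x y] xyd; apply: (pmin (x, y)); rewrite in_setE; apply/SP; split.
  exact: le_trans (ler_Re_modc (Complex x y - Complex x0 y0 : K)) xyd.
exact: le_trans (ler_Im_modc (Complex x y - Complex x0 y0 : K)) xyd.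
Qed.

Lemma peval_min_principle f (s A : R) z0 (d m : R) : 1 < s -> coefs_le f s A ->
  0 < d -> modc z0 + 2 * d < 1 -> (forall z, modc z <= 1 -> peval f z != 0) ->
  (forall z, modc (z - z0) = d -> m <= modc (peval f z)) ->
  m <= modc (peval f z0).
Proof.
move=> s1 fA d0 zd1 fn0 fm.
have [mu mu0 hmu] := peval_square_min s1 fA d0 zd1 fn0.
apply/ler_addgt0Pr => e e0.
(* The truncation error must stay below [mu], so that the polynomial has no zero in the small disc,
   and is paid twice within e: on the circle and at the centre. *)
pose eta := Num.min (mu / 2) (e / 2).
have eta0 : 0 < eta by rewrite lt_min !divr_gt0.
have [etam etae] : eta < mu /\ eta + eta <= e.
  split; first by rewrite gt_min ltr_pdivrMr // ltr_pMr // ltr1n.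
  by rewrite [leRHS]splitr lerD // ge_min lexx orbT.
have [n _ hn] := peval_unif_trunc 0 fA ler01 s1 eta0.
clearbody eta.
(* The affine change of variable carries the unit disc to the disc of radius d about z0, and 0 to
   z0. *)
pose q : {poly K} := (\poly_(i < n) f i) \Po (rc d *: 'X + z0%:P).
have qE w : q.[w] = psum f (z0 + rc d * w) n.
  by rewrite horner_comp hornerD hornerZ hornerX hornerC horner_poly addrC.
have dw w : modc (z0 + rc d * w - z0) = d * modc w.
  by rewrite addrAC subrr add0r modcM modc_rc ger0_norm // ltW.
have in1 w : modc w <= 1 -> modc (z0 + rc d * w) <= 1.
  move=> w1; apply: le_trans (ler_modcD _ _) _.
  rewrite modcM modc_rc (ger0_norm (ltW d0)); apply: ltW; apply: le_lt_trans zd1.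
  rewrite lerD2l mulrC; apply: ler_wpM2r; first exact: ltW.
  by rewrite (le_trans w1) // ler1n.
have psum_ge w : modc w <= 1 -> modc (peval f (z0 + rc d * w)) - eta <= modc q.[w].
  move=> /in1 /hn h; rewrite qE lerBlDr -lerBlDl; exact: le_trans (ler_modcB _ _) h.
have qmin := @poly_min_principle R q (m - eta).
have : m - eta <= modc q.[0].
  apply: qmin => [w w1|w w1].
    rewrite -modc_gt0; apply: lt_le_trans (psum_ge w (ltW w1)).
    rewrite subr_gt0; apply: lt_le_trans etam _; apply: hmu.
    by rewrite dw ler_piMr // ltW.
  apply: le_trans (psum_ge w _); last by rewrite w1.
  by rewrite lerB // fm // dw w1 mulr1.
have := hn z0; rewrite qE mulr0 addr0.
have z01 : modc z0 <= 1 by have := in1 0; rewrite mulr0 addr0 modc0; apply.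
move=> /(_ z01); rewrite (modcB (peval f z0)) => h1 h2.
rewrite -lerBlDr; apply: le_trans (_ : m - (eta + eta) <= _); first exact: lerB.
rewrite opprD addrA lerBlDr (le_trans h2) // -lerBlDl.
exact: le_trans (ler_modcB _ _) h1.
Qed.

(** If f(z0) = 0, then |f| >= c r^m on a small circle about z0. A zero-free g within c r^m / 2 of f
    has modulus at least c r^m / 2 on that circle, hence at z0 by the minimum principle, while
    closeness to f(z0) = 0 makes it smaller. *)
Lemma hurwitz f (s A : R) z0 : 1 < s -> coefs_le f s A -> f 0%N != 0 ->
  modc z0 < 1 ->
  (forall e : R, 0 < e -> exists g t B, [/\ 1 < t, coefs_le g t B,
     forall z, modc z <= 1 -> peval g z != 0 &
     forall z, modc z <= 1 -> modc (peval g z - peval f z) < e]) ->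
  peval f z0 != 0.
Proof.
move=> s1 fA f0 z01 approx; apply/eqP => fz0.
have z00 : 0 < modc z0.
  by rewrite modc_gt0; apply: contraNneq f0 => z00; rewrite -fz0 z00 peval0.
have [m [c [d [c0 d0 hc]]]] := zero_order s1 fA z00 z01 f0.
(* The first bound keeps the circle where the order estimate holds, the second gives |z0| + 2r <
   1. *)
pose r := Num.min (d / 2) ((1 - modc z0) / 4).
have r0 : 0 < r by rewrite lt_min !divr_gt0 // subr_gt0.
have rd : r < d by rewrite gt_min ltr_pdivrMr // ltr_pMr // ltr1n.
have zr1 : modc z0 + 2 * r < 1.
  have : r <= (1 - modc z0) / 4 by rewrite ge_min lexx orbT.
  by move: (modc z0) r z01 {r0 rd hc z00} => x r; clear; lra.
clearbody r.
have mm0 : 0 < c * r ^+ m by rewrite mulr_gt0 ?exprn_gt0.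
have [|g [t [B [t1 gB gn0 gf]]]] := approx (c * r ^+ m / 2).
  by rewrite divr_gt0.
suff : c * r ^+ m / 2 <= modc (peval g z0).
  by rewrite leNgt; have := gf _ (ltW z01); rewrite fz0 subr0 => ->.
apply: (peval_min_principle t1 gB r0 zr1 gn0) => z zr.
have fz : c * r ^+ m <= modc (peval f z) by rewrite -zr hc // zr.
have z1 : modc z <= 1.
  have := ler_modcB z z0; rewrite zr.
  by move: (modc z) (modc z0) zr1 r0 => x y; clear; lra.
have h1 := le_trans (ler_modcB (peval f z) (peval g z)).
have := h1 (c * r ^+ m / 2); rewrite (modcB (peval f z)) => /(_ (ltW (gf _ z1))).
by move: (modc _) (modc _) (c * _) fz => x y u; clear; lra.
Qed.

End Hurwitz.

(** * The two inclusions of the duality theorem *)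

Section Duality.
Variable R : realType.
Local Notation K := (C R).
Implicit Types (f g h : pser R) (z w : K) (U : set (pser R)).
#[local] Opaque peval modc.

Lemma hadamard_Px f g x y : hadamard (Px x f) (Px y g) = Px (x * y) (hadamard f g).
Proof. by apply/funext => k; rewrite /hadamard /Px exprMn mulrACA. Qed.

Lemma Px1 f : Px 1 f = f.
Proof. by apply/funext => k; rewrite /Px expr1n mulr1. Qed.

Lemma lt1_modc z : (`|z| < 1) = (modc z < 1).
Proof. exact: (modc_lt z 1). Qed.

Lemma le1_modc z : (`|z| <= 1) = (modc z <= 1).
Proof. exact: (modc_le z 1). Qed.

Lemma A0_Px g x : A0 g -> modc x <= 1 -> A0 (Px x g).
Proof.
move=> [gA g0] x1; split; last by rewrite /Px expr0 mulr1.
move=> z z1; rewrite /pconv series_psum.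
have -> : psum (Px x g) z = psum g (x * z) by apply/funext => n; exact: psum_rot.
rewrite -series_psum; apply: gA; rewrite lt1_modc modcM.
by rewrite lt1_modc in z1; apply: le_lt_trans z1; rewrite ler_piMl ?modc_ge0.
Qed.

Lemma dual_star_Px_perp U g x : dual_star U g -> modc x < 1 -> perp (cm U) (Px x g).
Proof.
move=> [gA0 gU] x1; split; first by apply: A0_Px => //; exact: ltW.
move=> _ [f [y [Uf [y1 ->]]]]; rewrite hadamard_Px peval_Px mulr1; apply: gU => //.
rewrite le1_modc in y1; rewrite lt1_modc modcM.
by apply: le_lt_trans x1; rewrite ler_piMl ?modc_ge0.
Qed.

Lemma dual_star_sub U : dual_star U `<=` Aclosure (perp (cm U)).
Proof.
move=> g gU; have [[gA g0] _] := gU; split=> // rC eC /real_of_gt0[r r0 ->] r1.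
move=> /real_of_gt0[e e0 ->]; have {}r1 : r < 1 by move: r1; rewrite (rc_lt _ 1).
have [t rt t1] : exists2 t, r < t & t < 1 by exists ((1 + r) / 2); lra.
have [A gtA] := Aan_coefs_le gA (ltW (lt_trans r0 rt)) t1.
have [L L0 lipL] := peval_lipschitz gtA r0 rt.
(* Dilation by 1 - d moves a point of the disc by at most d, hence changes the value of g by at most
   L d < e. *)
pose d := Num.min (1 / 2) (e / (2 * (L + 1))).
have L10 : 0 < 2 * (L + 1) by rewrite mulr_gt0 // ltr_wpDl.
have d0 : 0 < d by rewrite lt_min !divr_gt0.
have d1 : d < 1 by rewrite gt_min ltr_pdivrMr // mul1r ltr1n.
have Ld : L * d < e.
  have : d <= e / (2 * (L + 1)) by rewrite ge_min lexx orbT.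
  rewrite ler_pdivlMr //; move: L0 e0 d0; clear; move: d => d; lra.
clearbody d.
have mx : modc (rc (1 - d)) = 1 - d by rewrite modc_rc ger0_norm // subr_ge0 ltW.
exists (Px (rc (1 - d)) g); split.
  by apply: dual_star_Px_perp => //; rewrite mx gtrBl.
move=> z; rewrite modc_le modc_lt peval_Px => zr.
have xzr : modc (rc (1 - d) * z) <= r.
  rewrite modcM mx; apply: le_trans zr; rewrite ler_piMl ?modc_ge0 //.
  by rewrite gerBl ltW.
apply: le_lt_trans (lipL _ _ xzr zr) _; apply: le_lt_trans Ld.
apply: ler_wpM2l => //.
have -> : rc (1 - d) * z - z = - (rc d * z).
  have -> : rc (1 - d) = 1 - rc d by exact: (rmorphB (real_complex R) 1 d).
  by rewrite mulrBl mul1r addrAC subrr add0r.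
rewrite modcN modcM modc_rc (ger0_norm (ltW d0)) ler_piMr ?ltW //.
exact: le_lt_trans zr r1.
Qed.

(** Evaluation at 0 carries the normalisation to the limit; the radius 1/2 is arbitrary. *)
Lemma Aclosure_A0 (S : set (pser R)) h : S `<=` @A0 R -> Aclosure S h -> A0 h.
Proof.
move=> SA [hA hS]; split => //; apply/eqP; rewrite -subr_eq0 -modc_eq0.
rewrite eq_le modc_ge0 andbT; apply/ler_addgt0Pr => e e0; rewrite add0r.
have [|||g [/SA[_ g0] /(_ 0)]] := hS (rc (1 / 2)) (rc e).
- by rewrite -[0]/(rc 0) rc_lt divr_gt0.
- by rewrite (rc_lt _ 1) ltr_pdivrMr // mul1r ltr1n.
- by rewrite -[0]/(rc 0) rc_lt.
rewrite modc_le modc_lt modc0 !peval0 g0 modcB => h0.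
by apply: ltW; apply: h0; rewrite divr_ge0.
Qed.

Lemma Aclosure_perp_sub U : U `<=` @A0cl R ->
  Aclosure (perp (cm U)) `<=` dual_star U.
Proof.
move=> UA h hcl; have [hA hS] := hcl.
have hA0 : A0 h by apply: Aclosure_A0 hcl => g [].
split=> // f Uf z; rewrite lt1_modc => z1.
have [fcl f0] := UA _ Uf; have [s [A [s1 fA]]] := Acl_coefs_le fcl.
have s0 : 0 < s := lt_trans ltr01 s1.
(* Since f has radius s > 1, some r < 1 still has s r > 1, so f * h is controlled beyond the closed
   unit disc. The witness is the midpoint of 1/s and 1. *)
have [r [r0 r1 sr1]] : exists r, [/\ 0 < r, r < 1 & 1 < s * r].
  exists ((1 + s^-1) / 2); have sV0 : 0 < s^-1 by rewrite invr_gt0.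
  have sV1 : s^-1 < 1 by rewrite invf_lt1.
  split; [lra|lra|rewrite mulrA mulrDr mulfV ?lt0r_neq0 // mulr1; lra].
have [t rt t1] : exists2 t, r < t & t < 1 by exists ((1 + r) / 2); lra.
have t0 : 0 < t := lt_trans r0 rt.
have [B hB] := Aan_coefs_le hA (ltW r0) r1.
have [B' hB'] := Aan_coefs_le hA (ltW t0) t1.
apply: (hurwitz sr1 (coefs_le_hadamard (ltW s0) (ltW r0) fA hB)) => //.
  by rewrite /hadamard f0 (proj2 hA0) mul1r oner_neq0.
move=> e e0; have A0 := coefs_le_ge0 fA.
have sr0 : 0 < 1 - (s * r)^-1 by rewrite subr_gt0 invf_lt1 // (lt_trans ltr01).
(* Chosen so that A e' / (1 - 1/(s r)), the bound on f * (g - h) over the closed unit disc, is below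
   e. *)
pose e' := e * (1 - (s * r)^-1) / (A + 1).
have A1 : 0 < A + 1 by rewrite ltr_wpDl.
have e'0 : 0 < e' by rewrite divr_gt0 ?mulr_gt0.
have [|||g [[[gA g0] gU] gh]] := hS (rc r) (rc e').
- by rewrite -[0]/(rc 0) rc_lt.
- by rewrite (rc_lt _ 1).
- by rewrite -[0]/(rc 0) rc_lt.
have [G gG] := Aan_coefs_le gA (ltW r0) r1.
have [G' gG'] := Aan_coefs_le gA (ltW t0) t1.
have fg := coefs_le_hadamard (ltW s0) (ltW r0) fA gG.
have fh := coefs_le_hadamard (ltW s0) (ltW r0) fA hB.
exists (hadamard f g), (s * r), (A * G); split => // w w1.
  (* The rotations and dilations in [cm U] make f * g zero-free on the whole closed disc: (f * g)(w)
     = (P_w f * g)(1). *)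
  have : cm U (Px w f) by exists f, w; rewrite le1_modc.
  by move/gU; rewrite -{1}(Px1 g) hadamard_Px peval_Px !mulr1.
have wsr : modc w < s * r := le_lt_trans w1 sr1.
rewrite -pevalB; [|exact: coefs_le_pconv fg wsr|exact: coefs_le_pconv fh wsr].
(* Cauchy's estimate on the circle of radius r turns uniform closeness into coefficient bounds,
   which the Hadamard product with f carries to radius s r. The radius t in (r, 1) gives the
   convergence beyond r that this requires. *)
have ghe : coefs_le (fun k => g k - h k) r e'.
  apply: (peval_coef_le (coefs_leB (ltW t0) gG' hB') (ltW r0) rt) => x xr.
  have xt : modc x < t by rewrite xr.
  rewrite pevalB; [|exact: coefs_le_pconv gG' xt|exact: coefs_le_pconv hB' xt].
  by apply: ltW; have := gh x; rewrite modc_le modc_lt xr; apply.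
have := peval_le (coefs_le_hadamard (ltW s0) (ltW r0) fA ghe) wsr.
have -> : hadamard f (fun k => g k - h k) = (fun k => hadamard f g k - hadamard f h k).
  by apply/funext => k; rewrite /hadamard mulrBr.
move=> /le_lt_trans; apply.
have w0 : 0 < 1 - modc w / (s * r).
  by rewrite subr_gt0 ltr_pdivrMr ?mul1r // (lt_trans ltr01).
rewrite ltr_pdivrMr //; apply: (@lt_le_trans _ _ (e * (1 - (s * r)^-1))).
  rewrite /e' mulrA ltr_pdivrMr // mulrC ltr_pM2l ?mulr_gt0 //.
  by rewrite ltrDl.
apply: ler_wpM2l; first exact: ltW.
by rewrite lerB // ler_piMl // invr_ge0 ltW // (lt_trans ltr01).
Qed.

End Duality.

Theorem mainTheorem2 (R : realType) (U : set (pser R)) :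
  U `<=` @A0cl R -> dual_star U = Aclosure (perp (cm U)).
Proof.
move=> UA; apply/seteqP; split; first exact: dual_star_sub.
exact: Aclosure_perp_sub.
Qed.
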